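(* Let $\mathbb{H},\mathbb{H}'$ be complete Heyting algebras and let $f:\mathbb{H}\to\mathbb{H}'$ be a function preserving arbitrary suprema and finite infima. Let $\tilde f\subseteq V^{(\mathbb{H})}\times V^{(\mathbb{H}')}$ be the relation defined in the context. Then the domain of $\tilde f$ is total: for every $x\in V^{(\mathbb{H})}$ there exists $x'\in V^{(\mathbb{H}')}$ such that $x\mathrel{\tilde f}x'$.
   Context: For a complete Heyting algebra $\mathbb{H}$, define by recursion on ordinals $V^{(\mathbb{H})}_\alpha=\{x : x \text{ is a function from a set } X \text{ to } \mathbb{H},\ X\subseteq V^{(\mathbb{H})}_\beta \text{ for some } \beta<\alpha\}$, and $V^{(\mathbb{H})}=\bigcup_{\alpha} V^{(\mathbb{H})}_\alpha$. For $x,y\in V^{(\mathbb{H})}$ define, by simultaneous well-founded recursion, $$[\![x\in y]\!]=\bigvee_{u\in\mathrm{dom}(y)} y(u)\wedge[\![x=u]\!],\qquad [\![x=y]\!]=\bigwedge_{v\in\mathrm{dom}(x)}\big(x(v)\to[\![v\in y]\!]\big)\wedge\bigwedge_{u\in\mathrm{dom}(y)}\big(y(u)\to[\![u\in x]\!]\big).$$ The class $V^{(\mathbb{H}')}$ and its valuation are defined in the same way from $\mathbb{H}'$. Definition of $\tilde f$: by recursion on the ordinal $\alpha$, for $x\in V^{(\mathbb{H})}$ and $y\in V^{(\mathbb{H}')}$, $x\mathrel{\tilde f_\alpha}y$ if and only if there is a surjection $\varepsilon:\mathrm{dom}(x)\to\mathrm{dom}(y)$ such that $y\circ\varepsilon=f\circ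 x$ and, for every $u\in\mathrm{dom}(x)$, there exist $v\in V^{(\mathbb{H}')}$ and $\beta<\alpha$ with $u\mathrel{\tilde f_\beta}v$ and $[\![v=\varepsilon(u)]\!]=1$ (valuation in $\mathbb{H}'$). Finally $\tilde f=\bigcup_{\alpha}\tilde f_\alpha$, the union over all ordinals. *)

(* Defs.v *)
From HB Require Import structures.
From mathcomp Require Import all_boot all_order.
From mathcomp Require Import boolp classical_sets.

Set Implicit Arguments.
Unset Strict Implicit.
Unset Printing Implicit Defensive.

Import Order.TTheory.
Local Open Scope classical_set_scope.
Local Open Scope order_scope.

(** * Complete Heyting algebras *)

HB.mixin Record Lattice_isCompleteHeyting (d : Order.disp_t) T
    of Order.TBLattice d T := {
  supremums_neq0 : forall A : set T, supremums A !=set0;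
  infimums_neq0 : forall A : set T, infimums A !=set0;
  himp : T -> T -> T;
  lexI_himp : forall x y z : T, (Order.meet z x <= y) = (z <= himp x y)
}.

#[short(type="completeHeytingType")]
HB.structure Definition CompleteHeyting (d : Order.disp_t) :=
  { T of Order.TBLattice d T & Lattice_isCompleteHeyting d T }.

(* The first argument of [supremum] and [infimum] is the value taken on the
   empty set, hence the choice of \bot and \top. *)
Definition hsup d (H : completeHeytingType d) (A : set H) : H :=
  supremum \bot A.
Definition hinf d (H : completeHeytingType d) (A : set H) : H :=
  infimum \top A.

Definition preserves_sups d d' (H : completeHeytingType d)
    (H' : completeHeytingType d') (f : H -> H') : Prop :=
  forall A : set H, f (hsup A) = hsup (f @` A).

Definition preserves_finite_infs d d' (H : completeHeytingType d)
    (H' : completeHeytingType d') (f : H -> H') : Prop :=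
  forall s : seq H, f (\meet_(h <- s) h) = \meet_(h <- s) f h.

(* The universe of sets: index types of names and of ordinals, as well as the
   carriers of the Heyting algebras, live in it. Names and ordinals form
   classes, i.e. live in a strictly larger universe. *)
Definition Small := Type.

(** * Ordinals *)

(* [OSup A g] is the least ordinal strictly above all the [g a]. An ordinal is
   thus represented by an arbitrary cofinal set of smaller ones, so that it has
   several representatives; nothing below depends on the representative since
   only [olt] is used. *)
Inductive ord : Type := OSup (A : Small) (g : A -> ord).

Fixpoint ole (a b : ord) : Prop :=
  match a, b with
  | OSup A g, OSup B h => forall i : A, exists j : B, ole (g i) (h j)
  end.

Definition olt (a b : ord) : Prop :=
  match b with OSup B h => exists j : B, ole a (h j) end.

Lemma ole_trans b a c : ole a b -> ole b c -> ole a c.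
Proof.
elim: b a c => B h IH [A g] [C k] /= ab bc i.
have [j gh] := ab i; have [l hk] := bc j.
by exists l; apply: IH hk.
Qed.

Lemma olt_wf : well_founded olt.
Proof.
elim=> A g IH; constructor=> b /= [i bi].
constructor=> c cb; apply: (Acc_inv (IH i)).
case: b (g i) bi cb => B h [C k] /= bi [j cj].
by have [l hl] := bi j; exists l; apply: ole_trans hl.
Qed.

(** * Names *)

(* Set-sized families of pairs; [PName A n a] stands for the set of pairs
   [{(n i, a i) | i : A}]. *)
Inductive pname (H : Small) : Type :=
  PName (A : Small) (n : A -> pname H) (a : A -> H).

Definition pdom (H : Small) (x : pname H) : Small :=
  match x with PName A _ _ => A end.

Definition pelt (H : Small) (x : pname H) : pdom x -> pname H :=
  match x with PName A n _ => n end.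

Definition pval (H : Small) (x : pname H) : pdom x -> H :=
  match x with PName A _ a => a end.

(* Equality of the sets denoted by families of pairs (extensionality). *)
Fixpoint peq (H : Small) (x y : pname H) : Prop :=
  match x, y with
  | PName A n a, PName B m b =>
      (forall i : A, exists j : B, peq (n i) (m j) /\ a i = b j) /\
      (forall j : B, exists i : A, peq (n i) (m j) /\ a i = b j)
  end.

(* [x] is a function from a set to [H]: its domain, the set of the [pelt x i],
   is indexed without repetition by the type [pdom x], so that elements of the
   domain and elements of [pdom x] are the same thing. *)
Definition is_function (H : Small) (x : pname H) : Prop :=
  forall i j : pdom x, peq (pelt i) (pelt j) -> i = j.

(* [Valpha a x] : x belongs to V^(H)_a. *)
Definition Valpha (H : Small) : ord -> pname H -> Prop :=
  Fix olt_wf (fun _ => pname H -> Prop)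
    (fun a (rec : forall b, olt b a -> pname H -> Prop) x =>
       is_function x /\
       exists b, exists ba : olt b a, forall i : pdom x, rec b ba (pelt i)).

Lemma ValphaE (H : Small) a (x : pname H) :
  Valpha a x <->
  is_function x /\ exists2 b, olt b a & forall i : pdom x, Valpha b (pelt i).
Proof.
rewrite {1}/Valpha Fix_eq -/(@Valpha H) => [|b r s rs].
  split=> -[fx]; first by case=> b [ba xb]; split=> //; exists b.
  by case=> b ba xb; split=> //; exists b, ba.
have -> // : r = s by do 2!apply: functional_extensionality_dep => ?.
Qed.

Definition inV (H : Small) (x : pname H) : Prop := exists a, Valpha a x.

Lemma inV_elt (H : Small) (x : pname H) (i : pdom x) : inV x -> inV (pelt i).
Proof. by case=> a /ValphaE[_ [b _ xb]]; exists b. Qed.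

Definition V (H : Small) : Type := {x : pname H | inV x}.

Definition name_of (H : Small) (x : V H) : pname H := proj1_sig x.
Coercion name_of : V >-> pname.

Definition velt (H : Small) (x : V H) (i : pdom x) : V H :=
  exist _ (pelt i) (inV_elt i (proj2_sig x)).

(** * Heyting-valued equality and membership *)

Variant psub (H : Small) (p : pname H * pname H) :
    pname H * pname H -> Prop :=
| PSubL (i : pdom p.1) (j : pdom p.2) : psub p (pelt i, pelt j)
| PSubR (i : pdom p.1) (j : pdom p.2) : psub p (pelt j, pelt i).

Lemma psub_wf (H : Small) : well_founded (fun q p => @psub H p q).
Proof.
suff W x y : Acc (fun q p => @psub H p q) (x, y) /\
             Acc (fun q p => @psub H p q) (y, x) by case=> x y; case: (W x y).
elim: x y => A n IH a [B m b].
split; constructor=> q; case=> /= i j; by [case: (IH i (m j)) | case: (IH j (m i))].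
Qed.

(* [veq (x, y)] is [[x = y]]; the inner suprema are [[v \in y]] and
   [[u \in x]], see [veqE]. *)
Definition veq_pair d (H : completeHeytingType d) : pname H * pname H -> H :=
  Fix (@psub_wf H) (fun _ => H : Type)
    (fun p (rec : forall q, psub p q -> H) =>
       Order.meet
         (hinf (range (fun i : pdom p.1 => himp (pval i)
            (hsup (range (fun j : pdom p.2 =>
               Order.meet (pval j) (rec _ (PSubL i j))))))))
         (hinf (range (fun j : pdom p.2 => himp (pval j)
            (hsup (range (fun i : pdom p.1 =>
               Order.meet (pval i) (rec _ (PSubR i j))))))))).

Definition veq d (H : completeHeytingType d) (x y : pname H) : H :=
  veq_pair (x, y).

Definition vmem d (H : completeHeytingType d) (x y : pname H) : H :=
  hsup (range (fun j : pdom y => Order.meet (pval j) (veq x (pelt j)))).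

Lemma veqE d (H : completeHeytingType d) (x y : pname H) :
  veq x y =
  Order.meet
    (hinf (range (fun i : pdom x => himp (pval i) (vmem (pelt i) y))))
    (hinf (range (fun j : pdom y => himp (pval j) (vmem (pelt j) x)))).
Proof.
rewrite {1}/veq /veq_pair Fix_eq // => p r s rs.
have -> // : r = s by do 2!apply: functional_extensionality_dep => ?.
Qed.

(** * The relation induced by [f] *)

Definition ftilde_alpha d d' (H : completeHeytingType d)
    (H' : completeHeytingType d') (f : H -> H') : ord -> V H -> V H' -> Prop :=
  Fix olt_wf (fun _ => V H -> V H' -> Prop)
    (fun a (rec : forall b, olt b a -> V H -> V H' -> Prop) x y =>
       exists e : pdom x -> pdom y,
         [/\ (forall j : pdom y, exists i : pdom x, e i = j),
             (forall i : pdom x, pval (e i) = f (pval i)) &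
             (forall i : pdom x, exists (v : V H') (b : ord) (ba : olt b a),
                rec b ba (velt i) v /\ veq v (velt (e i)) = \top)]).

Lemma ftilde_alphaE d d' (H : completeHeytingType d)
    (H' : completeHeytingType d') (f : H -> H') a (x : V H) (y : V H') :
  ftilde_alpha f a x y <->
  exists e : pdom x -> pdom y,
    [/\ (forall j : pdom y, exists i : pdom x, e i = j),
        (forall i : pdom x, pval (e i) = f (pval i)) &
        (forall i : pdom x, exists (v : V H') (b : ord),
           [/\ olt b a, ftilde_alpha f b (velt i) v &
               veq v (velt (e i)) = \top])].
Proof.
rewrite {1}/ftilde_alpha Fix_eq -/(ftilde_alpha f) => [|b r s rs].
  split=> -[e [e_surj ef eP]]; exists e; split=> // i.
    by have [v [b [ba [fv ve]]]] := eP i; exists v, b.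
  by have [v [b [ba fv ve]]] := eP i; exists v, b, ba.
have -> // : r = s by do 2!apply: functional_extensionality_dep => ?.
Qed.

Definition ftilde d d' (H : completeHeytingType d)
    (H' : completeHeytingType d') (f : H -> H') (x : V H) (y : V H') : Prop :=
  exists a : ord, ftilde_alpha f a x y.

(* Main.v *)
Require Import Defs.
From mathcomp Require Import all_boot all_order.
From mathcomp Require Import boolp classical_sets.
From mathcomp Require wochoice.

(** By induction on names, every element [u] of the domain of [x] is related to
    some [v u] in V^(H'). The obvious candidate {(v u, f (x u)) | u} need not be
    a function, since distinct [u]'s may share the same [v u]. So [v u] is
    replaced by the name [v u] + {(w u, bot)}, which is equal to it with value
    top, where the [w u] are pairwise distinct and not in the domain of any of
    the [v u']: these names are then pairwise distinct. The [w u] are chosen by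
    recursion along a well-ordering of the domain of [x]. *)

Set Implicit Arguments.
Unset Strict Implicit.
Unset Printing Implicit Defensive.

Import Order.TTheory.
Local Open Scope classical_set_scope.
Local Open Scope order_scope.

Lemma ole_refl a : ole a a.
Proof. by elim: a => A g IH /= i; exists i. Qed.

Lemma olt_ole_trans b a c : olt a b -> ole b c -> olt a c.
Proof.
case: b c => [B h] [C k] /= [i ai] bc.
by have [j hk] := bc i; exists j; apply: ole_trans hk.
Qed.

Lemma olt_ole a b : olt a b -> ole a b.
Proof.
elim: b a => B h IH [A g] [j aj] i /=; exists j; apply: IH.
case: (h j) aj => C k aj; exact: aj.
Qed.

Lemma olt_OSup (A : Small) (g : A -> ord) i : olt (g i) (OSup g).
Proof. by exists i; apply: ole_refl. Qed.

Section Names.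
Variable H : Small.
Implicit Types x y z : pname H.

Lemma peqE x y :
  peq x y <->
  (forall i : pdom x, exists j : pdom y,
     peq (pelt i) (pelt j) /\ pval i = pval j) /\
  (forall j : pdom y, exists i : pdom x,
     peq (pelt i) (pelt j) /\ pval i = pval j).
Proof. by case: x y => A n a [B m b]. Qed.

Lemma peq_refl x : peq x x.
Proof. by elim: x => A n IH a; split=> i; exists i. Qed.

Lemma peq_sym x y : peq x y -> peq y x.
Proof.
elim: x y => A n IH a [B m b] [xy yx]; split=> i.
  by have [j [/IH ? ?]] := yx i; exists j.
by have [j [/IH ? ?]] := xy i; exists j.
Qed.

Lemma peq_trans y x z : peq x y -> peq y z -> peq x z.
Proof.
elim: y x z => B m IH b [A n a] [C k c] [xy yx] [yz zy]; split=> i.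
  have [j [nm ab]] := xy i; have [l [mk bc]] := yz j.
  by exists l; split; [apply: IH mk | rewrite ab].
have [j [mk bc]] := zy i; have [l [nm ab]] := yx j.
by exists l; split; [apply: IH mk | rewrite ab].
Qed.

(** Well-foundedness of names: if [x] equalled its element at [j], that element, lying in the domain
    of [x], would equal one of its own elements, which the induction excludes. *)
Lemma peq_pelt_irrefl x (j : pdom x) : ~ peq x (pelt j).
Proof.
elim: x j => A n IH a j /peqE[/(_ j)/= [k [njk _]] _].
exact: IH njk.
Qed.

Lemma Valpha_ole a b x : ole a b -> Valpha a x -> Valpha b x.
Proof.
move=> ab /ValphaE[fx [c ca xc]]; apply/ValphaE; split=> //.
by exists c => //; apply: olt_ole_trans ab.
Qed.

Lemma inV_is_function x : inV x -> is_function x.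
Proof. by case=> a /ValphaE[]. Qed.

Lemma inV_intro x :
  is_function x -> (forall i : pdom x, inV (pelt i)) -> inV x.
Proof.
(* [OSup g] bounds the ranks of all elements; the outer [OSup] over [unit] is its successor, a level
   containing [x]. *)
move=> fx /choice[g xg]; exists (OSup (fun _ : unit => OSup g)).
apply/ValphaE; split=> //; exists (OSup g); first exact: (olt_OSup _ tt).
by move=> i; apply: Valpha_ole (xg i); apply/olt_ole/olt_OSup.
Qed.

(* The domain of [w] is indexed by the [peq]-classes of the family [n], which
   may have repetitions. *)
Lemma exists_name_containing (h : H) (B : Small) (n : B -> V H) :
  exists w : V H, forall b, exists j : pdom w, peq (n b) (pelt j).
Proof.
pose cls b : B -> Prop := fun c => peq (n b) (n c).
pose C := {S : B -> Prop | exists b, S = cls b}.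
pose rep (S : C) : B := projT1 (cid (proj2_sig S)).
have repP S : sval S = cls (rep S) by rewrite /rep; case: cid.
pose w := PName (fun S : C => name_of (n (rep S))) (fun=> h).
have wV : inV w.
  apply: inV_intro => [S T /= ST|S]; last exact: proj2_sig.
  have : sval S = sval T.
    rewrite !repP; apply/funext => c; apply/propext.
    by split; apply: peq_trans => //; apply: peq_sym.
  by case: S T {ST} => S cS [T cT] /=; apply: eq_exist.
exists (exist _ w wV) => b /=.
have Cb : exists b', cls b = cls b' by exists b.
exists (exist _ (cls b) Cb); set S : C := exist _ _ _.
have clsE : cls b = cls (rep S) := repP S.
by rewrite -[peq _ _]/(cls b (rep S)) clsE; apply: peq_refl.
Qed.

(** A name with every [n b] in its domain equals none of them, by [peq_pelt_irrefl]. *)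
Lemma exists_fresh (h : H) (B : Small) (n : B -> V H) :
  exists w : V H, forall b, ~ peq w (n b).
Proof.
have [w nw] := exists_name_containing h n; exists w => b wb.
by have [j bj] := nw b; apply: (peq_pelt_irrefl (peq_trans wb bj)).
Qed.

End Names.

(** Supplies the order for the recursion in [exists_fresh_family]: the strict part of a
    well-order. *)
Lemma exists_wf_total (A : Type) :
  exists2 R : A -> A -> Prop, well_founded R &
    forall i j, [\/ i = j, R i j | R j i].
Proof.
have [R woR] := wochoice.well_ordering_principle {classic A}.
have R_anti := @wochoice.wo_chain_antisymmetric _ R predT (fun C _ => woR C).
have R_total (i j : A) : [\/ i = j, ~~ R j i | ~~ R i j].
  have [Rij|] := boolP (R i j); last by constructor 3.
  have [Rji|] := boolP (R j i); last by constructor 2.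
  constructor 1; apply: R_anti => //.
  by rewrite Rij Rji.
exists (fun i j : A => ~~ R j i); last exact: R_total.
move=> i; apply: contrapT => nacc_i.
(* A least non-accessible element would have only accessible predecessors, hence be accessible. *)
pose nacc := [pred k : {classic A} | `[< ~ Acc (fun i j => ~~ R j i) k >]].
have [|z [[]]] := woR nacc.
  by exists i; apply/asboolP.
move=> /asboolP nacc_z z_min _; apply: nacc_z; constructor=> y Rzy.
by apply: contrapT => nacc_y; move/negP: Rzy; apply; apply/z_min/asboolP.
Qed.

Lemma exists_fresh_family (H : Small) (h : H) (A B : Small) (n : B -> V H) :
  exists w : A -> V H,
    (forall i b, ~ peq (w i) (n b)) /\
    (forall i j, peq (w i) (w j) -> i = j).
Proof.
have [R R_wf R_total] := exists_wf_total A.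
(* The names to avoid at stage [i]: all the [n b] and the names already chosen at earlier stages.
   They form a small family, so [exists_fresh] applies. *)
pose prev i (rec : forall j, R j i -> V H) (b : B + {j : A | R j i}) : V H :=
  match b with inl b => n b | inr (exist j ji) => rec j ji end.
pose step i rec : V H := projT1 (cid (exists_fresh h (prev i rec))).
pose w := Fix R_wf (fun _ => V H) step.
have wE i : w i = step i (fun j _ => w j).
  rewrite /w Fix_eq // => k r s rs.
  by have -> // : r = s by do 2!apply: functional_extensionality_dep => ?.
have wP i : forall b, ~ peq (w i) (prev i (fun j _ => w j) b).
  by rewrite wE /step; case: cid.
have w_lt j i : R j i -> ~ peq (w i) (w j).
  by move=> ji; apply: (wP i (inr (exist _ j ji))).
exists w; split=> [i b|i j wij]; first exact: (wP i (inl b)).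
by have [//|/w_lt|/w_lt //] := R_total i j; case; apply: peq_sym.
Qed.

Definition adjoin (H : Small) (h : H) (v w : pname H) : pname H :=
  PName (fun o : option (pdom v) => if o is Some j then pelt j else w)
        (fun o => if o is Some j then pval j else h).

Lemma adjoin_inV (H : Small) (h : H) (v w : V H) :
  (forall j : pdom v, ~ peq w (pelt j)) -> inV (adjoin h v w).
Proof.
move=> wv; apply: inV_intro => [|[j|]]; last exact: proj2_sig.
  move=> [i|] [j|] //=; last by move/wv.
    by move/(inV_is_function (proj2_sig v)) ->.
  by move/peq_sym/wv.
exact: inV_elt (proj2_sig v).
Qed.

(** The entry [w] must match an entry of the second name, and the hypothesis leaves only the
    adjoined one. *)
Lemma peq_adjoin (H : Small) (h h' : H) (v v' w w' : pname H) :
  (forall j : pdom v', ~ peq w (pelt j)) ->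
  peq (adjoin h v w) (adjoin h' v' w') -> peq w w'.
Proof. by move=> wv' /peqE[/(_ None)/= [[j|] []] // /wv']. Qed.

Section Valuation.
Context {d : Order.disp_t} {H : completeHeytingType d}.
Implicit Types x y : H.

Lemma hinf_range_top (I : Type) (F : I -> H) :
  (forall i, F i = \top) -> hinf (range F) = \top.
Proof.
(* On an empty range the infimum is its default value [\top]. *)
move=> F1; rewrite /hinf /infimum; case: ifP => // _; apply: le_anti.
rewrite lex1 /=; have /(xgetPex \top)[_] := infimums_neq0 (range F).
by apply=> _ [i _ <-]; rewrite F1.
Qed.

Lemma hsup_range_ge (I : Type) (F : I -> H) i : F i <= hsup (range F).
Proof.
rewrite /hsup /supremum; case: ifPn => [/eqP/seteqP[F0 _]|_].
  by case: (F0 (F i)); exists i.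
by have /(xgetPex \bot)[+ _] := supremums_neq0 (range F); apply; exists i.
Qed.

Lemma himp_eq_top x y : x <= y -> himp x y = \top.
Proof. by move=> xy; apply: le_anti; rewrite lex1 -lexI_himp meet1x. Qed.

Lemma vmem_pelt_ge (u v : pname H) (j : pdom v) :
  veq u (pelt j) = \top -> pval j <= vmem u v.
Proof.
by move=> uj; apply: le_trans (hsup_range_ge _ j); rewrite uj meetx1.
Qed.

Lemma veq_refl (v : pname H) : veq v v = \top.
Proof.
elim: v => A n IH a; rewrite veqE !hinf_range_top ?meetxx // => i;
  exact/himp_eq_top/vmem_pelt_ge/IH.
Qed.

(** Common entries agree on both sides, and the extra one contributes an implication from [\bot],
    which is [\top] whatever [w] is. *)
Lemma veq_adjoin_bot (v w : pname H) : veq v (adjoin \bot v w) = \top.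
Proof.
rewrite veqE !hinf_range_top ?meetxx // => [[j|]|j].
- exact/himp_eq_top/(vmem_pelt_ge (v := v) (j := j))/veq_refl.
- by rewrite himp_eq_top ?le0x.
- exact/himp_eq_top/(vmem_pelt_ge (v := adjoin _ _ _) (j := Some j))/veq_refl.
Qed.

End Valuation.

Theorem theorem3p4 (d d' : Order.disp_t) (H : completeHeytingType d)
    (H' : completeHeytingType d') (f : H -> H')
    (f_sups : preserves_sups f) (f_infs : preserves_finite_infs f) :
  forall x : V H, exists x' : V H', ftilde f x x'.
Proof.
case=> x; elim: x => A n IH a xV.
pose x : V H := exist _ (PName n a) xV.
have /choice[v /choice[b fv]] :
    forall i : A, exists v, ftilde f (@velt H x i) v by move=> i; apply: IH.
(* All elements of the domains of all the [v i] together: [peq_adjoin] compares different indices,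
   so each [w i] must avoid the domain of every [v j]. *)
pose u (p : {i : A & pdom (v i)}) : V H' := velt (projT2 p).
have [w [w_u w_inj]] := @exists_fresh_family H' \bot A _ u.
have wv i j (k : pdom (v j)) : ~ peq (w i) (pelt k).
  exact: (w_u i (existT _ j k)).
have eV i : inV (adjoin \bot (v i) (w i)) by apply/adjoin_inV/wv.
pose y := PName (fun i => adjoin \bot (v i) (w i)) (fun i => f (a i)).
have yV : inV y.
  apply: inV_intro => // i j eij; apply: w_inj.
  by apply: peq_adjoin eij; apply: wv.
(* [y] is indexed by [A] itself, so the surjection is the identity; [OSup b] is strictly above every
   [b i]. *)
exists (exist _ y yV), (OSup b); apply/ftilde_alphaE; exists id; split=> //.
  by move=> j; exists j.
move=> i; exists (v i), (b i); split; [exact: olt_OSup|exact: fv|].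
exact: veq_adjoin_bot.
Qed.
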